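(* Fix a positive integer $q\ge3$. Let $\beta_c=\frac{2(q-1)}{q-2}\log(q-1)$, and for $\beta>0$ let $s(\beta)$ denote the largest root of the equation $$s=\frac{1-e^{-\beta s}}{1+(q-1)e^{-\beta s}}.$$ Then the following hold. (a) The quantity $s(\beta)$ is well defined. It is positive, strictly increasing, and differentiable with respect to $\beta$ in an open interval containing $[\beta_c,\infty)$. Also, $s(\beta_c)=(q-2)/(q-1)$ and $\lim_{\beta\to\infty}s(\beta)=1$. (b) For $\beta\ge\beta_c$, define $\nu^1=\nu^1(\beta)=\varphi(s(\beta))$ and let $\nu^i$ ($i=1,2,\dots,q$) denote the points in $\mathbb{R}^q$ obtained by interchanging the first and the $i$th coordinates of $\nu^1$. Then the set $\mathcal{E}_\beta$ of equilibrium macrostates of the Potts model on the complete bipartite graph is $$\mathcal{E}_\beta=\begin{cases}\{(\rho,\rho)\}&\text{for }0<\beta<\beta_c,\\ \{(\nu^1,\nu^1),\dots,(\nu^q,\nu^q)\}&\text{for }\beta>\beta_c,\\ \{(\rho,\rho),(\nu^1,\nu^1),\dots,(\nu^q,\nu^q)\}&\text{for }\beta=\beta_c.\end{cases}$$ For all $\beta\ge\beta_c$, the points in $\mathcal{E}_\beta$ listed above are all distinct. The point $\nu^1(\beta_c)$ equals $\varphi(s(\beta_c))=\varphi((q-2)/(q-1))$.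
   Context: $\mathcal{P}_q=\{\nu\in\mathbb{R}^q:\nu_k\ge0,\ \sum_{k=1}^q\nu_k=1\}$; $\rho=(1/q,\dots,1/q)\in\mathcal{P}_q$; $R(\nu|\rho)=\sum_{k=1}^q\nu_k\log(\nu_k/\rho_k)$ is the relative entropy (with $0\log0=0$). For $\beta>0$ and $(\gamma,\nu)\in\mathcal{P}_q\times\mathcal{P}_q$ set $$\alpha_\beta(\gamma,\nu)=\beta\langle\gamma,\nu\rangle-R(\gamma|\rho)-R(\nu|\rho),$$ where $\langle\cdot,\cdot\rangle$ is the Euclidean inner product. The set of equilibrium macrostates of the Potts model on the complete bipartite graph is $$\mathcal{E}_\beta=\{(\gamma,\nu)\in\mathcal{P}_q\times\mathcal{P}_q:(\gamma,\nu)\text{ maximizes }\alpha_\beta\text{ over }\mathcal{P}_q\times\mathcal{P}_q\}$$ (equivalently, the zero set of the rate function $I_\beta=\sup_{\mathcal{P}_q\times\mathcal{P}_q}\alpha_\beta-\alpha_\beta$). The function $\varphi:[0,1]\to\mathcal{P}_q$ is $$\varphi(s)=\big(q^{-1}[1+(q-1)s],\,q^{-1}(1-s),\dots,q^{-1}(1-s)\big).$$ *)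

(* Defs.v *)
From mathcomp Require Import all_boot all_order all_algebra.
From mathcomp Require Import all_classical all_reals all_analysis.
Import Order.TTheory GRing.Theory Num.Theory.
Import numFieldNormedType.Exports.
Local Open Scope classical_set_scope.
Local Open Scope ring_scope.

Section Potts.
Context {R : realType}.
Implicit Types (q : nat) (beta s : R).

Definition simplex q : set 'rV[R]_q :=
  [set v | (forall k, 0 <= v 0 k) /\ \sum_k v 0 k = 1].

Definition inner {q} (u v : 'rV[R]_q) : R := \sum_k u 0 k * v 0 k.

(* The convention 0 log 0 = 0 holds because 0 * x = 0 for every x. *)
Definition relative_entropy {q} (v r : 'rV[R]_q) : R :=
  \sum_k v 0 k * ln (v 0 k / r 0 k).

Definition rho q : 'rV[R]_q := const_mx q%:R^-1.

Definition alpha {q} beta (x : 'rV[R]_q * 'rV[R]_q) : R :=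
  beta * inner x.1 x.2 - relative_entropy x.1 (rho q)
  - relative_entropy x.2 (rho q).

Definition equilibrium q beta : set ('rV[R]_q * 'rV[R]_q) :=
  [set x | (simplex q `*` simplex q) x /\
    forall y, (simplex q `*` simplex q) y -> alpha beta y <= alpha beta x].

Definition phi q s : 'rV[R]_q :=
  \row_(k < q) if (k : nat) == 0%N then q%:R^-1 * (1 + (q%:R - 1) * s)
               else q%:R^-1 * (1 - s).

Definition beta_c q : R := 2 * (q%:R - 1) / (q%:R - 2) * ln (q%:R - 1).

Definition is_root_s q beta s : Prop :=
  s = (1 - expR (- (beta * s))) / (1 + (q%:R - 1) * expR (- (beta * s))).

Definition is_largest_root_s q beta s : Prop :=
  is_root_s q beta s /\ forall t, is_root_s q beta t -> t <= s.

(* xget returns the junk value 0 when there is no largest root, so this is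
   meaningful only together with existence and uniqueness of that root. *)
Definition s_of q beta : R := xget 0 [set s | is_largest_root_s q beta s].

(* Coordinates are numbered from 0; an index i : 'I_q witnesses 0 < q. *)
Definition first_index {q} (i : 'I_q) : 'I_q :=
  Ordinal (leq_ltn_trans (leq0n i) (ltn_ord i)).

Definition nu1 q beta : 'rV[R]_q := phi q (s_of q beta).

Definition nu {q} beta (i : 'I_q) : 'rV[R]_q :=
  xcol (first_index i) i (nu1 q beta).

End Potts.

(* Main.v *)
Require Import Defs.
From mathcomp Require Import all_boot all_order all_algebra.
From mathcomp Require Import all_classical all_reals all_analysis.
From mathcomp Require Import perm ring lra.
Import Order.TTheory GRing.Theory Num.Theory.
Import numFieldNormedType.Exports.
Local Open Scope classical_set_scope.
Local Open Scope ring_scope.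

(** Write c = q - 1 and h(s) = ln (1 + c s) - ln (1 - s).  Solving the defining
equation for exp (- beta s) shows that its roots are exactly the zeros of
D(s) = beta s - h(s) with s < 1 and 1 + c s > 0 ([is_root_sP]).  On [0, 1) the
derivative of D is beta - q / ((1 + c s) (1 - s)), which increases up to
s0 = (c - 1) / (2 c) and decreases afterwards: D is convex, then concave.  Hence
D has at most one zero beyond any p >= s0 with D(p) > 0, and D crosses zero there
downwards ([denergy_root_uniq], [d2energy_lt0_root]).

At beta_c the function D is antisymmetric about s0 ([denergy_antisym]), so it
vanishes at 0, s0 and 2 s0 = (q - 2) / (q - 1), and is positive strictly between
the last two.  Fixing p between s0 and 2 s0, every beta > h(p) / p, a threshold
smaller than beta_c, satisfies D(p) > 0; the intermediate value theorem puts
s(beta) beyond p, and s(beta) is there a local inverse of s |-> h(s) / s, whose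
derivative does not vanish.  This gives the first part.

For the second part, completing the square in the inner product gives
alpha(v, w) = P(v) + P(w) - (beta / 2) |v - w|^2, where P(v) is half of
alpha(v, v), so the equilibria are the pairs (v, v) with v a maximizer of P on
the simplex ([equilibriumE]).  P is a sum over the coordinates of one function e,
and moving mass between two coordinates of a maximizer must not increase P.  As
e' is infinite at 0, all coordinates are positive; all have the same e'; and as
e' increases beyond 1 / beta and decreases before it, at most one coordinate
exceeds 1 / beta and the others are equal.  So a maximizer is
phi(s), up to a transposition of coordinates, for some s in [0, 1) with D(s) = 0
([maximizer_shape]).  On these points P is, up to constants, the primitive B of D
with B(0) = 0 ([macro_energy_phi_at]).  The antisymmetry of D makes B at beta_c
nonpositive, with zeros exactly 0 and 2 s0 ([energy_lt0]); B at any other beta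
differs from it by (beta - beta_c) s^2 / 2.  For beta < beta_c this leaves s = 0
alone.  For beta > beta_c the maximum of B is positive, which forces its location
beyond s0, where s(beta) is the only zero of D. *)

(** * The one-dimensional energy and its derivatives *)

(** The mean value theorem for a function differentiable on the closed interval. *)
Lemma mvt {R : realType} (f df : R -> R) (a b : R) :
  a < b -> (forall x, a <= x -> x <= b -> is_derive x 1 f (df x)) ->
  exists x, [/\ a < x, x < b & f b - f a = df x * (b - a)].
Proof.
move=> ab fE; have [||x] := @MVT R f df a b ab.
- by move=> x; rewrite in_itv/= => /andP[ax xb]; apply: fE; exact: ltW.
- apply: derivable_within_continuous => x; rewrite in_itv/= => /andP[ax xb].
  by have [] := fE x ax xb.
- by rewrite in_itv/= => /andP[ax xb] ->; exists x.
Qed.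

Section OneDim.
Context {R : realType} (c : R).
Hypothesis c1 : 1 < c.
Implicit Types (beta s t p : R).

(** The function h: a root of the defining equation satisfies beta s = h(s). *)
Definition log_ratio s : R := ln (1 + c * s) - ln (1 - s).

(** The function D, derivative of [energy] in s; the roots of the
defining equation are its zeros s < 1 with 1 + c s > 0. *)
Definition denergy beta s : R := beta * s - log_ratio s.

(** The primitive B of D that vanishes at 0. *)
Definition energy beta s : R :=
  beta * s ^+ 2 / 2 - ((1 + c * s) / c * ln (1 + c * s) + (1 - s) * ln (1 - s)).

(** The derivative of D; here c + 1 stands for q. *)
Definition d2energy beta s : R := beta - (c + 1) / ((1 + c * s) * (1 - s)).

(** The point s0 where D passes from convex to concave. *)
Definition inflection : R := (c - 1) / (2 * c).

(** The critical inverse temperature beta_c in terms of c = q - 1. *)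
Definition transition_beta : R := 2 * c / (c - 1) * ln c.

(** The value (q - 2) / (q - 1) of the root at beta_c. *)
Definition transition_s : R := (c - 1) / c.

Lemma c_gt0 : 0 < c. Proof. by have := c1; lra. Qed.

Lemma cs_gt0 s : 0 <= s -> 0 < 1 + c * s.
Proof. by move=> s0; rewrite ltr_wpDr// mulr_ge0// ltW// c_gt0. Qed.

Lemma transition_sE : transition_s = 2 * inflection.
Proof. by rewrite /transition_s /inflection; field; rewrite gt_eqF// c_gt0. Qed.

Lemma mulc_transition_s : c * transition_s = c - 1.
Proof. by rewrite /transition_s; field; rewrite gt_eqF// c_gt0. Qed.

Lemma inflection_gt0 : 0 < inflection.
Proof. by rewrite /inflection divr_gt0//; have := c1; lra. Qed.

Lemma transition_s_lt1 : transition_s < 1.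
Proof. by rewrite /transition_s ltr_pdivrMr; have := c1; lra. Qed.

Lemma is_derive_ln1D s : 0 < 1 + c * s ->
  is_derive s 1 (fun t : R => ln (1 + c * t)) (c / (1 + c * s)).
Proof.
move=> cs; have dln := is_derive1_ln cs.
have dlin : is_derive s (1 : R) (fun t : R => 1 + c * t) c.
  by apply: is_derive_eq; rewrite /GRing.scale/=; ring.
have /is_derive_eq :=
  @is_derive1_comp _ (@ln R) (fun t => 1 + c * t) s _ _ dln dlin.
by apply; rewrite mulrC.
Qed.

Lemma is_derive_ln1B s : s < 1 ->
  is_derive s 1 (fun t : R => ln (1 - t)) (- (1 - s)^-1).
Proof.
rewrite -subr_gt0 => s1s; have dln := is_derive1_ln s1s.
have dlin : is_derive s (1 : R) (fun t : R => 1 - t) (-1).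
  by apply: is_derive_eq; ring.
have /is_derive_eq :=
  @is_derive1_comp _ (@ln R) (fun t => 1 - t) s _ _ dln dlin.
by apply; rewrite mulrN1.
Qed.

Lemma is_derive_log_ratio s : 0 <= s -> s < 1 ->
  is_derive s 1 log_ratio ((c + 1) / ((1 + c * s) * (1 - s))).
Proof.
move=> s0 slt1; have cs := cs_gt0 _ s0.
have e1 := is_derive_ln1D s cs; have e2 := is_derive_ln1B s slt1.
have /is_derive_eq := is_deriveB e1 e2; apply.
by field; rewrite ?gt_eqF// subr_gt0.
Qed.

Lemma is_derive_denergy beta s : 0 <= s -> s < 1 ->
  is_derive s 1 (denergy beta) (d2energy beta s).
Proof.
move=> s0 slt1.
have l3 : is_derive s (1:R) (fun t : R => beta * t) beta.
  by apply: is_derive_eq; rewrite /GRing.scale/=; ring.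
exact: (is_deriveB l3 (is_derive_log_ratio s s0 slt1)).
Qed.

Lemma is_derive_energy beta s : 0 <= s -> s < 1 ->
  is_derive s 1 (energy beta) (denergy beta s).
Proof.
move=> s0 slt1; have cs := cs_gt0 _ s0; have s1s : 0 < 1 - s by lra.
have e1 := is_derive_ln1D s cs; have e2 := is_derive_ln1B s slt1.
have l1 : is_derive s (1:R) (fun t : R => (1 + c * t) / c) 1.
  apply: is_derive_eq; rewrite /GRing.scale/=; field.
  by rewrite gt_eqF// c_gt0.
have l2 : is_derive s (1:R) (fun t : R => 1 - t) (-1).
  by apply: is_derive_eq; ring.
have l3 : is_derive s (1:R) (fun t : R => beta * t ^+ 2 / 2) (beta * s).
  by apply: is_derive_eq; rewrite /GRing.scale/=; field.
have /is_derive_eq :=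
  is_deriveB l3 (is_deriveD (is_deriveM l1 e1) (is_deriveM l2 e2)).
apply; rewrite /denergy /log_ratio /GRing.scale/=.
by field; rewrite ?gt_eqF// c_gt0.
Qed.

Lemma denergy_mvt beta s t : 0 <= s -> s < t -> t < 1 ->
  exists x, [/\ s < x, x < t &
    denergy beta t - denergy beta s = d2energy beta x * (t - s)].
Proof.
move=> s0 st t1; apply: mvt => // x sx xt.
by apply: is_derive_denergy; lra.
Qed.

Lemma energy_mvt beta s t : 0 <= s -> s < t -> t < 1 ->
  exists x, [/\ s < x, x < t &
    energy beta t - energy beta s = denergy beta x * (t - s)].
Proof.
move=> s0 st t1; apply: mvt => // x sx xt.
by apply: is_derive_energy; lra.
Qed.

Lemma d2energy_decr beta s t : inflection <= s -> s < t -> t < 1 ->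
  d2energy beta t < d2energy beta s.
Proof.
move=> ls st t1.
have i0 := inflection_gt0; have c0 := c_gt0; have := c1 => ?.
have ci : 2 * c * inflection = c - 1.
  by rewrite /inflection; field; rewrite gt_eqF.
rewrite /d2energy ltrD2l ltrN2 ltr_pM2l; last by lra.
have pos x : 0 <= x -> x < 1 -> 0 < (1 + c * x) * (1 - x).
  by move=> x0 x1; rewrite mulr_gt0 ?cs_gt0//; lra.
rewrite ltf_pV2 ?posrE ?pos//; try lra.
rewrite -subr_gt0.
have -> : (1 + c * s) * (1 - s) - (1 + c * t) * (1 - t) =
  (t - s) * (c * (s + t) - (c - 1)) by ring.
rewrite mulr_gt0//; first lra.
(* s + t > 2 s0 = (c - 1) / c *)
nra.
Qed.

Lemma d2energy_incr beta s t : 0 <= s -> s < t -> t <= inflection ->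
  d2energy beta s < d2energy beta t.
Proof.
move=> is0 st t1.
have i0 := inflection_gt0; have c0 := c_gt0; have := c1 => ?.
have i1 := transition_s_lt1; have i2 := transition_sE.
have ci : 2 * c * inflection = c - 1.
  by rewrite /inflection; field; rewrite gt_eqF.
rewrite /d2energy ltrD2l ltrN2 ltr_pM2l; last by lra.
have pos x : 0 <= x -> x < 1 -> 0 < (1 + c * x) * (1 - x).
  by move=> x0 x1; rewrite mulr_gt0 ?cs_gt0//; lra.
rewrite ltf_pV2 ?posrE ?pos//; try lra.
rewrite -subr_gt0.
have -> : (1 + c * t) * (1 - t) - (1 + c * s) * (1 - s) =
  (t - s) * ((c - 1) - c * (s + t)) by ring.
rewrite mulr_gt0//; first lra.
(* s + t < 2 s0 = (c - 1) / c *)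
nra.
Qed.

(** Beyond s0, a zero of D reached from a positive value is crossed with a
negative slope: D has decreased between p and s, and D' is decreasing. *)
Lemma d2energy_lt0_root beta p s : inflection <= p -> p < s -> s < 1 ->
  0 < denergy beta p -> denergy beta s = 0 -> d2energy beta s < 0.
Proof.
move=> ip ps slt1 Dp Ds; have i0 := inflection_gt0.
have [|x [px xs]] := denergy_mvt beta p s _ ps slt1; first lra.
rewrite Ds sub0r => xE.
have : d2energy beta s < d2energy beta x by apply: d2energy_decr; lra.
have : d2energy beta x < 0 by nra.
lra.
Qed.

Lemma denergy_lt0_after beta p s t : inflection <= p -> p < s -> s < t -> t < 1 ->
  0 < denergy beta p -> denergy beta s = 0 -> denergy beta t < 0.
Proof.
move=> ip ps st t1 Dp Ds; have i0 := inflection_gt0.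
have : d2energy beta s < 0.
  by apply: (@d2energy_lt0_root _ p) => //; lra.
have [|x [sx xt]] := denergy_mvt beta s t _ st t1; first lra.
rewrite Ds subr0 => -> ?.
have : d2energy beta x < d2energy beta s by apply: d2energy_decr; lra.
nra.
Qed.

Lemma denergy_root_uniq beta p s t : inflection <= p -> p < s -> s < 1 ->
  p < t -> t < 1 -> 0 < denergy beta p ->
  denergy beta s = 0 -> denergy beta t = 0 -> s = t.
Proof.
move=> ip ps slt1 pt t1 Dp Ds Dt.
case: (ltgtP s t) => // st.
- by have := denergy_lt0_after _ _ _ _ ip ps st t1 Dp Ds; rewrite Dt ltxx.
- by have := denergy_lt0_after _ _ _ _ ip pt st slt1 Dp Dt; rewrite Ds ltxx.
Qed.

Lemma denergy0 beta : denergy beta 0 = 0.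
Proof. by rewrite /denergy /log_ratio !(mulr0, subr0, addr0, subrr). Qed.

Lemma energy0 beta : energy beta 0 = 0.
Proof.
by rewrite /energy !(mulr0, subr0, addr0, expr0n) ln1
  !(mulr0, mul0r, addr0, subr0).
Qed.

Lemma denergy_shift beta beta' s :
  denergy beta' s = denergy beta s + (beta' - beta) * s.
Proof. by rewrite /denergy; ring. Qed.

Lemma energy_shift beta beta' s :
  energy beta' s = energy beta s + (beta' - beta) * s ^+ 2 / 2.
Proof. by rewrite /energy; field; rewrite gt_eqF ?c_gt0. Qed.

Lemma transition_betaM : transition_beta * transition_s = 2 * ln c.
Proof.
rewrite /transition_beta /transition_s; field; rewrite !gt_eqF ?c_gt0//.
all: by have := c1; lra.
Qed.

(** * The energy at the transition *)

(** Replacing s by 2 s0 - s exchanges 1 + c s and c (1 - s). *)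
Lemma denergy_antisym s : 0 <= s -> s < 1 -> s <= transition_s ->
  denergy transition_beta (transition_s - s) = - denergy transition_beta s.
Proof.
move=> s0 slt1 ss1; have c0 := c_gt0; have cs := cs_gt0 _ s0.
rewrite /denergy /log_ratio.
have -> : 1 + c * (transition_s - s) = c * (1 - s) by rewrite mulrBr mulc_transition_s; ring.
have -> : 1 - (transition_s - s) = (1 + c * s) / c.
  by rewrite /transition_s; field; rewrite gt_eqF.
rewrite ln_div ?posrE// lnM ?posrE//; last lra.
rewrite mulrBr transition_betaM; ring.
Qed.

Lemma denergy_transition_s : denergy transition_beta transition_s = 0.
Proof.
have i0 := inflection_gt0; have := transition_sE => ?.
have := denergy_antisym 0; rewrite subr0 denergy0 oppr0; apply; lra.
Qed.

Lemma denergy_inflection : denergy transition_beta inflection = 0.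
Proof.
have i0 := inflection_gt0; have := transition_sE => ?; have := transition_s_lt1 => ?.
have := denergy_antisym inflection.
have -> : transition_s - inflection = inflection by lra.
by move=> H; have := H _ _ _; lra.
Qed.

(** D vanishes at both ends of an interval on which it is strictly concave. *)
Lemma denergy_gt0_mid s : inflection < s -> s < transition_s ->
  0 < denergy transition_beta s.
Proof.
move=> ls ss1; have := transition_s_lt1 => ?; have i0 := inflection_gt0.
rewrite ltNge; apply/negP => Ds.
have [||x [px xs]] := denergy_mvt transition_beta inflection s _ ls _; [lra|lra|].
have [||y [sy ys1]] := denergy_mvt transition_beta s transition_s _ ss1 _; [lra|lra|].
rewrite denergy_transition_s denergy_inflection => Ey Ex.
have : d2energy transition_beta y < d2energy transition_beta x.
  by apply: d2energy_decr; lra.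
have : d2energy transition_beta x <= 0 by nra.
have : 0 <= d2energy transition_beta y by nra.
lra.
Qed.

Lemma denergy_lt0_left s : 0 < s -> s < inflection ->
  denergy transition_beta s < 0.
Proof.
move=> s0 si; have := transition_s_lt1 => ?; have := transition_sE => ?.
have := denergy_gt0_mid (transition_s - s); rewrite denergy_antisym; try lra.
Qed.

(** A base point strictly between s0 and 2 s0, where D at beta_c is positive. *)
Definition s_mid : R := 3 / 2 * inflection.

Lemma s_midP : inflection < s_mid /\ s_mid < transition_s.
Proof. by have := transition_sE; have := inflection_gt0; rewrite /s_mid; lra. Qed.

Lemma denergy_lt0_right s : transition_s < s -> s < 1 ->
  denergy transition_beta s < 0.
Proof.
move=> s1s slt1; have [? ?] := s_midP.
by apply: (@denergy_lt0_after _ s_mid transition_s) => //;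
  [lra|exact: denergy_gt0_mid|exact: denergy_transition_s].
Qed.

Lemma energy_transition_s : energy transition_beta transition_s = 0.
Proof.
have c0 := c_gt0.
rewrite /energy.
have -> : 1 + c * transition_s = c by rewrite mulc_transition_s; ring.
have -> : 1 - transition_s = c^-1 by rewrite /transition_s; field; rewrite gt_eqF.
rewrite lnV ?posrE// expr2 mulrA transition_betaM /transition_s.
by field; rewrite gt_eqF.
Qed.

(** B at beta_c decreases from 0 on [0, s0], increases back to 0 at 2 s0 and
decreases again. *)
Lemma energy_lt0 s : 0 < s -> s < 1 -> s != transition_s ->
  energy transition_beta s < 0.
Proof.
move=> s0 slt1 ss1; have := transition_s_lt1 => ?.
have i0 := inflection_gt0; have := transition_sE => ?.
have [si|si] := leP s inflection.
  have [||x [px xs]] := energy_mvt transition_beta 0 s _ s0 _; [lra|lra|].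
  rewrite energy0 !subr0 => ->.
  have : denergy transition_beta x < 0 by apply: denergy_lt0_left; lra.
  nra.
case: (ltgtP s transition_s) ss1 => // ss1 _.
  have [||x [px xs]] := energy_mvt transition_beta s transition_s _ ss1 _; [lra|lra|].
  rewrite energy_transition_s => E.
  have : 0 < denergy transition_beta x by apply: denergy_gt0_mid; lra.
  nra.
have [||x [px xs]] := energy_mvt transition_beta transition_s s _ ss1 _; [lra|lra|].
rewrite energy_transition_s => E.
have : denergy transition_beta x < 0 by apply: denergy_lt0_right; lra.
nra.
Qed.

(** On [0, s0] the convexity of D makes it nonpositive between two of its zeros,
so B cannot be positive at a zero of D there. *)
Lemma root_gt_inflection beta s : 0 < s -> s < 1 ->
  denergy beta s = 0 -> 0 < energy beta s -> inflection < s.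
Proof.
move=> s0 slt1 Ds Bs; rewrite ltNge; apply/negP => si.
have [||z [z0 zs]] := energy_mvt beta 0 s _ s0 _; [lra|lra|].
rewrite energy0 => Ez.
have [||x [x0 xz]] := denergy_mvt beta 0 z _ z0 _; [lra|lra|].
have [||y [zy ys]] := denergy_mvt beta z s _ zs _; [lra|lra|].
rewrite denergy0 Ds => Ey Ex.
have : d2energy beta x < d2energy beta y by apply: d2energy_incr; lra.
have ? : 0 < denergy beta z by nra.
have : 0 < d2energy beta x by nra.
have : d2energy beta y < 0 by nra.
lra.
Qed.

End OneDim.

(** * The largest root *)

Section LargestRoot.
Context {R : realType} (q : nat).
Hypothesis q3 : (3 <= q)%N.
Implicit Types (beta s t p : R).

Local Notation c := (q%:R - 1 : R).

Lemma q_ge3 : 3 <= q%:R :> R. Proof. by rewrite ler_nat. Qed.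

Lemma c_gt1 : 1 < c. Proof. by have := q_ge3; lra. Qed.

Lemma beta_cE : beta_c q = transition_beta c.
Proof. by rewrite /beta_c /transition_beta; congr (_ / _ * _); ring. Qed.

Lemma is_root_sP beta s :
  is_root_s q beta s <-> [/\ 0 < 1 + c * s, s < 1 & denergy c beta s = 0].
Proof.
have c0 : 0 < c by have := c_gt1; lra.
rewrite /is_root_s /denergy /log_ratio; set x := expR _.
have x0 : 0 < x by exact: expR_gt0.
have cx : 0 < 1 + c * x by rewrite ltr_wpDr// mulr_ge0// ltW.
split=> [sE|[cs slt1 /subr0_eq sE]].
  have cs : 1 + c * s = (c + 1) / (1 + c * x) by rewrite sE; field; rewrite gt_eqF.
  have oneBsE : 1 - s = (c + 1) * x / (1 + c * x) by rewrite sE; field; rewrite gt_eqF.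
  have cs0 : 0 < 1 + c * s by rewrite cs divr_gt0//; lra.
  have s1s : 0 < 1 - s by rewrite oneBsE divr_gt0// mulr_gt0//; lra.
  split=> //; first lra.
  rewrite -ln_div ?posrE//.
  have -> : (1 + c * s) / (1 - s) = x^-1.
    by rewrite cs oneBsE; field; rewrite !gt_eqF//; lra.
  by rewrite lnV ?posrE// expRK; ring.
have xE : x = (1 - s) / (1 + c * s).
  rewrite /x sE opprB -ln_div ?posrE ?subr_gt0// lnK// posrE divr_gt0//.
  by rewrite subr_gt0.
rewrite xE; field; rewrite !gt_eqF//=; nra.
Qed.

Lemma is_root_s0 beta : is_root_s q beta 0.
Proof. by apply/is_root_sP; rewrite denergy0 mulr0 addr0; split. Qed.

(** The right-hand side of the equation defining the roots. *)
Let mean_field beta t := (1 - expR (- (beta * t))) / (1 + c * expR (- (beta * t))).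

Lemma continuous_mean_field beta : continuous (mean_field beta).
Proof.
have c0 : 0 < c by have := c_gt1; lra.
move=> t; have cE : {for t, continuous (fun u : R => expR (- (beta * u)))}.
  apply: (@continuous_comp _ _ _ (fun u : R => - (beta * u)) (@expR R)).
    by apply: cvgN; apply: cvgM; [exact: cvg_cst|exact: cvg_id].
  exact: continuous_expR.
apply: cvgM; first by apply: cvgB; [exact: cvg_cst|exact: cE].
apply: cvgV; last first.
  by apply: cvgD; [exact: cvg_cst|apply: cvgM; [exact: cvg_cst|exact: cE]].
by rewrite gt_eqF// ltr_wpDr// mulr_ge0 ?expR_ge0// ltW.
Qed.

(** D(t) > 0 means that the right-hand side of the equation exceeds t at t, while
it is less than 1 at 1. *)
Lemma exists_root_above beta t : 0 <= t -> t < 1 -> 0 < denergy c beta t ->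
  exists s, [/\ t < s, s < 1 & is_root_s q beta s].
Proof.
have c0 : 0 < c by have := c_gt1; lra.
move=> t0 t1 Dt.
have Ft : t < mean_field beta t.
  have cs : 0 < 1 + c * t by rewrite ltr_wpDr// mulr_ge0// ltW.
  rewrite /mean_field; set x := expR _.
  have x0 : 0 < x by exact: expR_gt0.
  have cx : 0 < 1 + c * x by rewrite ltr_wpDr// mulr_ge0// ltW.
  have xlt : x < (1 - t) / (1 + c * t).
    rewrite -[ltRHS]lnK ?posrE ?divr_gt0 ?subr_gt0// ltr_expR.
    rewrite ln_div ?posrE ?subr_gt0//.
    by move: Dt; rewrite /denergy /log_ratio; lra.
  move: xlt; rewrite ltr_pdivlMr// ltr_pdivlMr//; lra.
have F1 : mean_field beta 1 < 1.
  rewrite /mean_field; have x0 := expR_gt0 (- (beta * 1)).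
  rewrite ltr_pdivrMr ?ltr_wpDr//; first nra.
  by rewrite mulr_ge0// ltW.
have [||s] := @IVT R (fun u => u - mean_field beta u) t 1 0 (ltW t1).
- apply: continuous_subspaceT => u.
  by apply: cvgB; [exact: cvg_id|exact: continuous_mean_field].
- by rewrite ge_min le_max subr_le0 (ltW Ft)/= !subr_ge0 (ltW F1) orbT.
rewrite in_itv/= => /andP[ts slt1] /subr0_eq sE.
exists s; split=> //; rewrite lt_neqAle ?ts ?slt1 andbT; apply/eqP => E.
- by move: Ft; rewrite E -sE ltxx.
- by move: F1; rewrite -E -sE ltxx.
Qed.

(** The roots in [0, 1] form a nonempty compact set, and no root exceeds 1. *)
Lemma exists_largest_root beta : exists s, is_largest_root_s q beta s.
Proof.
pose A := `[0, 1] `&` [set t | t = mean_field beta t].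
have A0 : A !=set0 by exists 0; split; [rewrite /= in_itv/= lexx ler01|exact: is_root_s0].
have Ac : compact A.
  apply: compact_closedI; first exact: segment_compact.
  rewrite (_ : [set t | _] = (fun t => t - mean_field beta t) @^-1` [set 0]).
    apply: preimage_closed; last exact: closed_eq.
    by move=> u _; apply: cvgB; [exact: cvg_id|exact: continuous_mean_field].
  apply/seteqP; split=> t /= => [{1}->|/subr0_eq//]; exact: subrr.
have [|s /[!inE] -[s01 sE] smax] := @compact_EVT_max _ R id A A0 Ac.
  by apply: continuous_subspaceT => u; exact: cvg_id.
exists s; split=> // t tr; have [t0|t0] := leP 0 t.
  apply: smax; rewrite inE; split=> //=; rewrite in_itv/= t0/=.
  by have /is_root_sP[_ /ltW] := tr.
by move: s01; rewrite /= in_itv/= => /andP[s0 _]; exact: le_trans (ltW t0) s0.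
Qed.

Lemma largest_root_uniq beta s t :
  is_largest_root_s q beta s -> is_largest_root_s q beta t -> s = t.
Proof. by move=> [sr sm] [tr tm]; apply/eqP; rewrite eq_le tm//= sm. Qed.

Lemma s_ofP beta : is_largest_root_s q beta (s_of q beta).
Proof.
have [s sP] := exists_largest_root beta.
exact: (@xgetI _ 0 [set s | is_largest_root_s q beta s] s).
Qed.

Lemma s_of_bounds beta : 0 <= s_of q beta < 1.
Proof.
have [sr sm] := s_ofP beta; rewrite sm; last exact: is_root_s0.
by have /is_root_sP[] := sr.
Qed.

Lemma denergy_s_of beta : denergy c beta (s_of q beta) = 0.
Proof. by have [/is_root_sP[]] := s_ofP beta. Qed.

Lemma s_of_gt beta t : 0 <= t -> t < 1 -> 0 < denergy c beta t -> t < s_of q beta.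
Proof.
move=> t0 t1 /(exists_root_above _ _ t0 t1)[s [ts _ sr]].
by apply: (lt_le_trans ts); have [_] := s_ofP beta; apply.
Qed.

Lemma s_of_eq beta p s : inflection c <= p -> p < s -> s < 1 ->
  0 < denergy c beta p -> denergy c beta s = 0 -> s_of q beta = s.
Proof.
move=> ip ps slt1 Dp Ds; have i0 := inflection_gt0 _ c_gt1.
have /andP[_ ?] := s_of_bounds beta.
apply: (@denergy_root_uniq _ c c_gt1 beta p) => //; last exact: denergy_s_of.
by apply: s_of_gt => //; lra.
Qed.

Lemma s_of_beta_c : s_of q (beta_c q) = transition_s c.
Proof.
have [? ?] := s_midP _ c_gt1; have i0 := inflection_gt0 _ c_gt1.
rewrite beta_cE; apply: (@s_of_eq _ (s_mid c)) => //; first exact: ltW.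
- exact: transition_s_lt1 c_gt1.
- exact: denergy_gt0_mid c_gt1 _ _ _.
- exact: denergy_transition_s c_gt1.
Qed.

(** A threshold beyond which D is positive at [s_mid]; it is below beta_c. *)
Definition beta_low : R := log_ratio c (s_mid c) / s_mid c.

Lemma s_mid_gt0 : 0 < s_mid c.
Proof. by have := s_midP _ c_gt1; have := inflection_gt0 _ c_gt1; lra. Qed.

Lemma denergy_s_mid beta : beta_low < beta -> 0 < denergy c beta (s_mid c).
Proof. by rewrite /beta_low ltr_pdivrMr ?s_mid_gt0// /denergy subr_gt0. Qed.

Lemma beta_low_lt : beta_low < beta_c q.
Proof.
rewrite beta_cE /beta_low ltr_pdivrMr ?s_mid_gt0// -subr_gt0.
by have [? ?] := s_midP _ c_gt1; exact: denergy_gt0_mid c_gt1 _ _ _.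
Qed.

Lemma beta_low_ge0 : 0 <= beta_low.
Proof.
have c1 := c_gt1; have m0 := s_mid_gt0.
have ? := transition_s_lt1 _ c_gt1; have [? ?] := s_midP _ c_gt1.
rewrite /beta_low divr_ge0 ?(ltW m0)// /log_ratio subr_ge0 ler_ln ?posrE; nra.
Qed.

Lemma s_of_gt_mid beta : beta_low < beta -> s_mid c < s_of q beta.
Proof.
move=> /denergy_s_mid; apply: s_of_gt; first exact: ltW s_mid_gt0.
by have := transition_s_lt1 _ c_gt1; have [? ?] := s_midP _ c_gt1; lra.
Qed.

(** Increasing beta makes D positive at the former largest root. *)
Lemma s_of_incr b1 b2 : beta_low < b1 -> b1 < b2 -> s_of q b1 < s_of q b2.
Proof.
move=> lb bb; have := s_of_gt_mid _ lb => ?; have := s_mid_gt0 => ?.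
have /andP[? ?] := s_of_bounds b1.
apply: s_of_gt => //; rewrite (@denergy_shift _ _ b1) denergy_s_of; nra.
Qed.

(** The inverse function theorem for G(s) = h(s) / s, whose derivative at s(beta)
is - D'(s(beta)) / s(beta) > 0. *)
Lemma derivable_s_of beta : beta_low < beta -> derivable (s_of q) beta 1.
Proof.
move=> lb; set s := s_of q beta.
have sm : s_mid c < s by exact: s_of_gt_mid.
have m0 := s_mid_gt0; have [im _] := s_midP _ c_gt1.
have /andP[s0 slt1] := s_of_bounds beta; rewrite -/s in s0 slt1.
pose G t := log_ratio c t / t.
have GE t : 0 < t -> denergy c (G t) t = 0.
  by move=> t0; rewrite /denergy /G divfK ?subrr// gt_eqF.
have Gs : G s = beta.
  have := denergy_s_of beta; rewrite -/s /G /denergy => /subr0_eq <-.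
  by rewrite mulfK// gt_eqF//; lra.
have dG t : 0 < t -> t < 1 -> is_derive t 1 G (- d2energy c (G t) t / t).
  move=> t0 t1; have dl := is_derive_log_ratio _ c_gt1 t (ltW t0) t1.
  have dV : is_derive t (1 : R) (fun u : R => u^-1) (- t ^- 2).
    have := @is_deriveV R (fun u => u) t 1 1; rewrite gt_eqF//.
    by move=> /(_ isT _)/is_derive_eq; apply; rewrite /GRing.scale/= mulr1.
  have /is_derive_eq := is_deriveM dl dV; apply.
  have cs := cs_gt0 _ c_gt1 t (ltW t0).
  rewrite /d2energy /G /GRing.scale/=; field.
  by rewrite !gt_eqF//; lra.
have -> : beta = G s by rewrite Gs.
apply: (@ex_derive _ _ _ _ _ _ (- d2energy c (G s) s / s)^-1).
apply: (@is_derive_inverse R G (s_of q)).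
- near=> t.
  have tm : s_mid c < t by near: t; exact: lt_nbhsr.
  have t1 : t < 1 by near: t; exact: lt_nbhsl.
  have Gt : beta_low < G t.
    near: t.
    have /differentiable_continuous : differentiable G s.
      by apply/derivable1_diffP; have [] := dG s (lt_trans m0 sm) slt1.
    by move=> /(_ _ (lt_nbhsr _)); apply; rewrite Gs.
  apply: (@s_of_eq _ (s_mid c)) => //; first exact: ltW.
    exact: denergy_s_mid.
  by apply: GE; lra.
- near=> t.
  have t0 : 0 < t by near: t; apply: lt_nbhsr; lra.
  have t1 : t < 1 by near: t; exact: lt_nbhsl.
  by apply/differentiable_continuous/derivable1_diffP; have [] := dG t t0 t1.
- exact: dG (lt_trans m0 sm) slt1.
- have sl : d2energy c (G s) s < 0.
    apply: (@d2energy_lt0_root _ _ c_gt1 _ (s_mid c)) => //; first exact: ltW.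
      by apply: denergy_s_mid; rewrite Gs.
    by apply: GE; lra.
  by rewrite gt_eqF// divr_gt0 ?oppr_gt0// (lt_trans m0 sm).
Unshelve. all: by end_near. Qed.

Lemma cvg_s_of : s_of q beta @[beta --> +oo] --> (1 : R).
Proof.
apply/cvgrPdist_lt => e e0.
(* The maximum with 1 / 2 keeps t positive when e is large. *)
pose t := Num.max (1 / 2) (1 - e / 2) : R.
have t0 : 0 < t by rewrite lt_max; apply/orP; left; lra.
have t1 : t < 1 by rewrite gt_max; apply/andP; split; lra.
have te : 1 - e < t by rewrite lt_max; apply/orP; right; lra.
near=> b.
have tb : t < s_of q b.
  apply: s_of_gt => //; first exact: ltW.
  rewrite /denergy subr_gt0 -ltr_pdivrMr//.
  by near: b; apply: nbhs_pinfty_gt; exact: num_real.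
have /andP[_ slt1] := s_of_bounds b.
by rewrite gtr0_norm ?subr_gt0//; lra.
Unshelve. all: by end_near. Qed.

End LargestRoot.

(** * The energy of one coordinate *)

Lemma ln_lt_sub1 {R : realType} (x : R) : 0 < x -> x != 1 -> ln x < x - 1.
Proof.
move=> x0 x1; have := @expR_gt1Dx R (ln x).
by rewrite ln_eq0// lnK ?posrE// => /(_ x1); lra.
Qed.

(** Continuity holds on the whole line because ln is 0 on nonpositive reals; at 0
it follows from |y ln y| <= 2 sqrt y for 0 < y < 1. *)
Lemma continuous_xlnx {R : realType} : continuous (fun x : R => x * ln x).
Proof.
move=> x; case: (ltgtP x 0) => [x0|x0|->].
- apply: cvg_near_cst; near=> y.
  have y0 : y < 0 by near: y; exact: lt_nbhsl.
  by rewrite (ln0 (ltW x0)) (ln0 (ltW y0)) !mulr0.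
- exact: (cvgM cvg_id (continuous_ln x0)).
- rewrite /continuous_at mul0r; apply/cvgrPdist_lt => e e0; near=> y.
  rewrite sub0r normrN; have [y0|y0] := leP y 0.
    by rewrite ln0// mulr0 normr0.
  have y1 : y < 1 by near: y; exact: lt_nbhsl.
  have ye : y < (e / 2) ^+ 2 by near: y; apply: lt_nbhsl; rewrite exprn_gt0// divr_gt0.
  have r0 : 0 < Num.sqrt y by rewrite sqrtr_gt0.
  have yE : y = Num.sqrt y ^+ 2 by rewrite sqr_sqrtr// ltW.
  have re : Num.sqrt y < e / 2.
    by rewrite -(@ltr_pXn2r _ 2) ?nnegrE -?yE// ?(ltW r0)// ltW// divr_gt0.
  have l0 : ln y < 0 by rewrite ln_lt0// y0 y1.
  have ly : - ln y < 2 * (Num.sqrt y)^-1.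
    have := @ln_sublinear R (Num.sqrt y)^-1; rewrite invr_gt0 => /(_ r0).
    have -> : ln y = 2 * ln (Num.sqrt y) by rewrite {1}yE lnXn// mulr_natl.
    by rewrite lnV ?posrE//; lra.
  rewrite ltr0_norm; last by rewrite pmulr_rlt0.
  rewrite -mulrN; apply: (@le_lt_trans _ _ (y * (2 * (Num.sqrt y)^-1))).
    by rewrite ler_pM2l// ltW.
  have -> : y * (2 * (Num.sqrt y)^-1) = 2 * Num.sqrt y.
    by rewrite {1}yE; field; rewrite gt_eqF.
  lra.
Unshelve. all: by end_near. Qed.

Section SiteEnergy.
Context {R : realType} (q : nat) (beta : R).
Hypothesis q0 : 0 < q%:R :> R.
Hypothesis beta0 : 0 < beta.

(** The contribution of one coordinate of v to half of alpha(v, v). *)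
Definition site_energy (x : R) : R :=
  beta / 2 * x ^+ 2 - x * ln (x / q%:R^-1).

(** The derivative of [site_energy] at positive points. *)
Definition site_slope (x : R) : R := beta * x - ln (x * q%:R) - 1.

Lemma continuous_site_energy : continuous site_energy.
Proof.
move=> x; apply: cvgB.
  by apply: cvgM; [exact: cvg_cst|apply: cvgM; exact: cvg_id].
have -> : (fun u : R => u * ln (u / q%:R^-1)) =
    (fun u => q%:R^-1 * (u * q%:R * ln (u * q%:R))).
  by apply/funext => u; rewrite invrK; field; rewrite gt_eqF.
rewrite invrK [X in _ --> X](_ : _ = q%:R^-1 * (x * q%:R * ln (x * q%:R))); last first.
  by field; rewrite gt_eqF.
apply: cvgM; first exact: cvg_cst.
apply: (@continuous_comp _ _ _ (fun u : R => u * q%:R) (fun u => u * ln u)).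
  by apply: cvgM; [exact: cvg_id|exact: cvg_cst].
exact: continuous_xlnx.
Qed.

Lemma is_derive_site_energy (x : R) : 0 < x ->
  is_derive x 1 site_energy (site_slope x).
Proof.
move=> x0; have xq : 0 < x / q%:R^-1 by rewrite invrK mulr_gt0.
have dln := is_derive1_ln xq.
have dlin : is_derive x (1 : R) (fun t : R => t / q%:R^-1) q%:R.
  by apply: is_derive_eq; rewrite /GRing.scale/= invrK; ring.
have dl := @is_derive1_comp _ (@ln R) (fun t => t / q%:R^-1) x _ _ dln dlin.
have dq : is_derive x (1:R) (fun t : R => beta / 2 * t ^+ 2) (beta * x).
  by apply: is_derive_eq; rewrite /GRing.scale/=; field.
have /is_derive_eq := is_deriveB dq (is_deriveM (is_derive_id x (1 : R)) dl); apply.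
rewrite /site_slope /GRing.scale/= !invrK; field.
by rewrite !gt_eqF.
Qed.

Lemma site_slope_incr (x y : R) : beta^-1 < x -> x < y -> site_slope x < site_slope y.
Proof.
move=> bx xy; have x0 : 0 < x by apply: lt_trans bx; rewrite invr_gt0.
have y0 : 0 < y by lra.
rewrite /site_slope !lnM ?posrE//.
have : ln (y / x) < y / x - 1.
  by apply: ln_lt_sub1; [rewrite divr_gt0|rewrite gt_eqF// ltr_pdivlMr// mul1r].
rewrite ln_div ?posrE//.
have -> : y / x - 1 = (y - x) * x^-1 by field; rewrite gt_eqF.
have : (y - x) * x^-1 < (y - x) * beta.
  rewrite ltr_pM2l ?subr_gt0// invf_plt ?posrE//.
lra.
Qed.

Lemma site_slope_decr (x y : R) : 0 < x -> x < y -> y <= beta^-1 ->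
  site_slope y < site_slope x.
Proof.
move=> x0 xy yb; have y0 : 0 < y by lra.
rewrite /site_slope !lnM ?posrE//.
have : ln (x / y) < x / y - 1.
  by apply: ln_lt_sub1; [rewrite divr_gt0|rewrite lt_eqF// ltr_pdivrMr// mul1r].
rewrite ln_div ?posrE//.
have -> : x / y - 1 = - ((y - x) * y^-1) by field; rewrite gt_eqF.
have : (y - x) * beta <= (y - x) * y^-1.
  rewrite ler_pM2l ?subr_gt0//.
  by rewrite -[beta]invrK lef_pV2 ?posrE// ?invr_gt0.
lra.
Qed.

(** The energy of two coordinates a and b after moving a mass t from the second to
the first. *)
Definition transfer (a b t : R) : R := site_energy (a + t) + site_energy (b - t).

Lemma is_derive_transfer (a b t : R) : 0 < a + t -> 0 < b - t ->
  is_derive t 1 (transfer a b) (site_slope (a + t) - site_slope (b - t)).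
Proof.
move=> at0 bt0.
have l1 : is_derive t (1 : R) (fun u : R => a + u) 1 by apply: is_derive_eq; ring.
have l2 : is_derive t (1 : R) (fun u : R => b - u) (-1) by apply: is_derive_eq; ring.
have d1 := @is_derive1_comp _ site_energy _ t _ _ (is_derive_site_energy _ at0) l1.
have d2 := @is_derive1_comp _ site_energy _ t _ _ (is_derive_site_energy _ bt0) l2.
have /is_derive_eq := is_deriveD d1 d2; apply.
by rewrite mulr1 mulrN1.
Qed.

Lemma continuous_transfer a b : continuous (transfer a b).
Proof.
move=> t; apply: cvgD.
  apply: (@continuous_comp _ _ _ (fun u : R => a + u) site_energy).
    by apply: cvgD; [exact: cvg_cst|exact: cvg_id].
  exact: continuous_site_energy.
apply: (@continuous_comp _ _ _ (fun u : R => b - u) site_energy).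
  by apply: cvgB; [exact: cvg_cst|exact: cvg_id].
exact: continuous_site_energy.
Qed.

Lemma transfer_gt (a b d : R) : 0 <= a -> 0 < d -> d < b ->
  (forall t : R, 0 < t -> t < d -> site_slope (b - t) < site_slope (a + t)) ->
  transfer a b 0 < transfer a b d.
Proof.
move=> a0 d0 db sl.
have [||x] := @MVT R (transfer a b)
    (fun t => site_slope (a + t) - site_slope (b - t)) 0 d d0.
- move=> t; rewrite in_itv/= => /andP[t0 td].
  by apply: is_derive_transfer; lra.
- by apply: continuous_subspaceT => t; exact: continuous_transfer.
rewrite in_itv/= => /andP[x0 xd] E.
by rewrite -subr_gt0 E subr0 mulr_gt0// subr_gt0 sl.
Qed.

(** The slope of [site_energy] is infinite at 0, so feeding an empty coordinate
pays off. *)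
Lemma transfer_empty_site (b : R) : 0 < b ->
  exists2 t, 0 <= t <= b & transfer 0 b 0 < transfer 0 b t.
Proof.
(* For t < b / (1 + K) one has ln ((b - t) / t) > ln K = beta * b, which exceeds
   the loss beta * (b - 2 t). *)
move=> b0; pose K := expR (beta * b).
have K0 : 0 < K by exact: expR_gt0.
have d0 : 0 < b / (1 + K) by rewrite divr_gt0// addr_gt0.
have db : b / (1 + K) < b.
  by rewrite ltr_pdivrMr ?addr_gt0// mulrDr mulr1 ltrDl mulr_gt0.
exists (b / (1 + K)); first by rewrite !ltW.
apply: transfer_gt => // t t0; rewrite ltr_pdivlMr ?addr_gt0// => td.
have bt : K * t < b - t by lra.
have bt0 : 0 < b - t by apply: lt_trans bt; rewrite mulr_gt0.
rewrite /site_slope add0r !lnM ?posrE//.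
have : ln (K * t) < ln (b - t) by rewrite ltr_ln ?posrE// mulr_gt0.
rewrite lnM ?posrE// /K expRK => H.
have : 0 < beta * t by rewrite mulr_gt0.
lra.
Qed.

(** Fermat's rule: t = 0 is an interior maximum. *)
Lemma transfer_max_slope (a b : R) : 0 < a -> 0 < b ->
  (forall t : R, - a <= t <= b -> transfer a b t <= transfer a b 0) ->
  site_slope a = site_slope b.
Proof.
move=> a0 b0 tmax.
have dt (t : R) : t \in `]- a, b[ -> derivable (transfer a b) t 1.
  rewrite in_itv/= => /andP[at0 tb].
  by have [] : is_derive t 1 (transfer a b) (site_slope (a + t) - site_slope (b - t));
    first by apply: is_derive_transfer; lra.
have ab : - a <= b by lra.
have zab : (0 : R) \in `]- a, b[ by rewrite in_itv/=; apply/andP; split; lra.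
have [|_ E1] := @derive1_at_max R (transfer a b) (- a) b 0 ab dt zab.
  move=> t; rewrite in_itv/= => /andP[at0 tb]; apply: tmax.
  by rewrite !ltW.
have [_ E2] : is_derive (0 : R) (1 : R) (transfer a b)
    (site_slope (a + 0) - site_slope (b - 0)).
  by apply: is_derive_transfer; lra.
by move: E2; rewrite E1 addr0 subr0 => /esym/subr0_eq.
Qed.

(** Beyond 1 / beta the energy of a coordinate is strictly convex, so it pays off
to move mass from the smaller to the larger of two such coordinates. *)
Lemma transfer_two_large (a b : R) : beta^-1 < b -> b <= a ->
  exists2 t, 0 <= t <= b & transfer a b 0 < transfer a b t.
Proof.
move=> bb ba; have bi : 0 < beta^-1 by rewrite invr_gt0.
exists (b - beta^-1); first by apply/andP; split; lra.
apply: transfer_gt; try lra.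
by move=> t t0 td; apply: site_slope_incr; lra.
Qed.

End SiteEnergy.

(** * Maximizers on the simplex *)

Section Simplex.
Context {R : realType} (q : nat) (beta : R).
Hypothesis q3 : (3 <= q)%N.
Hypothesis beta0 : 0 < beta.
Implicit Types (v w : 'rV[R]_q) (i j k : 'I_q) (s t : R).

Local Notation c := (q%:R - 1 : R).
Local Notation E := (site_energy q beta).

Let q0 : 0 < q%:R :> R. Proof. by have := @q_ge3 R _ q3; lra. Qed.
Let c1 : 1 < c. Proof. exact: c_gt1. Qed.

(** Half of alpha(v, v). *)
Definition macro_energy v : R := \sum_k E (v 0 k).

(** The maximizers of [macro_energy] over the simplex. *)
Definition maximizers : set 'rV[R]_q :=
  [set v | simplex q v /\ forall w, simplex q w -> macro_energy w <= macro_energy v].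

Lemma alphaE v w :
  alpha beta (v, w) = macro_energy v + macro_energy w
    - beta / 2 * \sum_k (v 0 k - w 0 k) ^+ 2.
Proof.
rewrite /alpha /inner /relative_entropy /macro_energy /=.
rewrite !mulr_sumr -!sumrB -big_split/= -sumrB; apply: eq_bigr => k _.
by rewrite /site_energy !mxE; field.
Qed.

Lemma alpha_diag v : alpha beta (v, v) = macro_energy v + macro_energy v.
Proof.
rewrite alphaE big1 ?mulr0 ?subr0// => k _.
by rewrite subrr expr0n.
Qed.

(** If (v, w) is an equilibrium then adding the inequalities against (v, v) and
(w, w) gives |v - w|^2 <= 0. *)
Lemma equilibriumE : equilibrium q beta = [set (v, v) | v in maximizers].
Proof.
apply/seteqP; split=> [[v w] [[/= sv sw] vwmax]|_ [v [sv vmax] <-]].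
  have := vwmax (v, v) (conj sv sv); have := vwmax (w, w) (conj sw sw).
  rewrite !alpha_diag alphaE; set S := \sum_k _ => Hw Hv.
  have S0 : 0 <= S by apply: sumr_ge0 => k _; exact: sqr_ge0.
  have {Hw Hv} SE : S = 0.
    have : beta / 2 * S <= 0 by lra.
    by rewrite pmulr_rle0 ?divr_gt0// => S1; apply/eqP; rewrite eq_le S1 S0.
  have vw : v = w.
    apply/rowP => k; apply/eqP; rewrite -subr_eq0 -sqrf_eq0.
    have /psumr_eq0P/(_ SE) SE' : forall k, true -> 0 <= (v 0 k - w 0 k) ^+ 2.
      by move=> ? _; exact: sqr_ge0.
    by rewrite SE'.
  rewrite -vw in vwmax *; exists v => //; split=> // u su.
  by have := vwmax (u, u) (conj su su); rewrite !alpha_diag; lra.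
split=> [//|[u w] [/= su sw]].
rewrite alpha_diag alphaE.
have := vmax _ su; have := vmax _ sw.
have : 0 <= beta / 2 * \sum_k (u 0 k - w 0 k) ^+ 2.
  by rewrite mulr_ge0 ?divr_ge0 ?(ltW beta0)//; apply: sumr_ge0 => k _; exact: sqr_ge0.
lra.
Qed.

Lemma continuous_macro_energy : continuous macro_energy.
Proof.
apply: continuous_big => [|k _]; first exact: add_continuous.
move=> v; apply: (@continuous_comp _ _ _ (fun v : 'rV[R]_q => v 0 k) E).
  exact: coord_continuous.
exact: continuous_site_energy.
Qed.

Lemma simplex_le1 v k : simplex q v -> 0 <= v 0 k <= 1.
Proof.
move=> [v0 v1]; rewrite v0/= -v1 (bigD1 k)//= lerDl.
by apply: sumr_ge0.
Qed.

Lemma compact_simplex : compact (simplex q : set 'rV[R]_q).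
Proof.
have -> : (simplex q : set 'rV[R]_q) =
    [set v : 'rV[R]_q | forall k, `[0, 1]%classic (v ord0 k)] `&`
    ((fun v : 'rV[R]_q => \sum_k v 0 k) @^-1` [set 1]).
  apply/seteqP; split=> v.
    move=> sv; split=> /= [k|]; last by case: sv.
    by rewrite in_itv/=; exact: simplex_le1.
  move=> [/= v01 v1]; split=> // k.
  by have := v01 k; rewrite /= in_itv/= => /andP[].
apply: compact_closedI.
  apply: (@rV_compact R q (fun=> `[0, 1]%classic)) => _; exact: segment_compact.
apply: preimage_closed; last exact: closed_eq.
move=> v _; apply: continuous_big => [|k _]; first exact: add_continuous.
exact: coord_continuous.
Qed.

Lemma rho_simplex : simplex q (rho q : 'rV[R]_q).
Proof.
split=> [k|]; first by rewrite mxE invr_ge0 ltW.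
under eq_bigr do rewrite mxE.
by rewrite sumr_const card_ord -[_ *+ _]mulr_natl mulfV// gt_eqF.
Qed.

Lemma maximizers_nonempty : maximizers !=set0.
Proof.
have [||v vs vmax] := @compact_EVT_max _ R macro_energy (simplex q) _ compact_simplex.
- by exists (rho q); exact: rho_simplex.
- by apply: continuous_subspaceT; exact: continuous_macro_energy.
exists v; rewrite inE in vs; split=> // w ws.
by apply: vmax; rewrite inE.
Qed.

(** The vector v after moving a mass t from coordinate j to coordinate i; meant
for distinct i and j. *)
Definition shift_mass v i j t : 'rV[R]_q :=
  \row_k (if k == i then v 0 i + t else if k == j then v 0 j - t else v 0 k).

Lemma sum_shift_mass (f : R -> R) v i j t : i != j ->
  \sum_k f (shift_mass v i j t 0 k) - \sum_k f (v 0 k) =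
  f (v 0 i + t) + f (v 0 j - t) - (f (v 0 i) + f (v 0 j)).
Proof.
move=> ij; have ji : j != i by rewrite eq_sym.
rewrite (bigD1 i)//= (bigD1 j)//= [X in _ - X](bigD1 i)//= [X in _ - (_ + X)](bigD1 j)//=.
rewrite !mxE !eqxx (negbTE ji).
rewrite (eq_bigr (fun k => f (v 0 k))) => [|k /andP[ki kj]]; first by ring.
by rewrite mxE (negbTE ki) (negbTE kj).
Qed.

Lemma shift_mass_simplex v i j t : i != j -> simplex q v ->
  - v 0 i <= t <= v 0 j -> simplex q (shift_mass v i j t).
Proof.
move=> ij [v0 v1] /andP[ti tj]; split.
  move=> k; rewrite mxE; case: ifP => _; first by lra.
  by case: ifP => _ //; lra.
have /= := sum_shift_mass id v i j t ij; rewrite v1 => H.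
by apply/eqP; rewrite -subr_eq0 H; apply/eqP; ring.
Qed.

Lemma maximizer_transfer v i j t : maximizers v -> i != j ->
  - v 0 i <= t <= v 0 j ->
  transfer q beta (v 0 i) (v 0 j) t <= transfer q beta (v 0 i) (v 0 j) 0.
Proof.
move=> [sv vmax] ij tb; have := vmax _ (shift_mass_simplex _ _ _ _ ij sv tb).
rewrite -subr_le0 /macro_energy sum_shift_mass// /transfer addr0 subr0; lra.
Qed.

Lemma maximizer_gt0 v k : maximizers v -> 0 < v 0 k.
Proof.
move=> vM; have [[v0 v1] _] := vM.
rewrite lt_neqAle v0 andbT eq_sym; apply/eqP => vk.
have [j vj] : exists j, 0 < v 0 j.
  apply: contrapT => /forallNP H; move: v1; rewrite big1 => [/eqP|j _].
    by rewrite eq_sym oner_eq0.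
  by apply/eqP; rewrite eq_le v0 andbT leNgt; apply/negP/H.
have kj : k != j by apply: contraTneq vj => <-; rewrite vk ltxx.
have [t tb] := @transfer_empty_site R q beta q0 beta0 (v 0 j) vj.
have := maximizer_transfer v k j t vM kj; rewrite vk oppr0 => /(_ tb).
by rewrite leNgt => /negP.
Qed.

Lemma maximizer_slope v i j : maximizers v ->
  site_slope q beta (v 0 i) = site_slope q beta (v 0 j).
Proof.
move=> vM; have [->//|ij] := eqVneq i j.
apply: transfer_max_slope => //; [exact: maximizer_gt0|exact: maximizer_gt0|].
by move=> t; exact: maximizer_transfer.
Qed.

(** Of two coordinates of a maximizer, the smaller one is at most 1 / beta. *)
Lemma maximizer_small v i j : maximizers v -> i != j -> v 0 j <= v 0 i ->
  v 0 j <= beta^-1.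
Proof.
move=> vM ij ji; rewrite leNgt; apply/negP => vb.
have [t /andP[t0 tb]] := @transfer_two_large R q beta q0 beta0 _ _ vb ji.
apply/negP; rewrite -leNgt maximizer_transfer// tb andbT.
by have := maximizer_gt0 v i vM; lra.
Qed.

(** The vector phi(s) with its first and i-th coordinates exchanged. *)
Definition phi_at i s : 'rV[R]_q := xcol (first_index i) i (phi q s).

Lemma phi_atE i s k :
  phi_at i s 0 k = if k == i then (1 + c * s) / q%:R else (1 - s) / q%:R.
Proof.
rewrite /phi_at !mxE.
have -> : (tperm (first_index i) i k : nat) == 0%N = (k == i).
  rewrite -[k == i](inj_eq (@perm_inj _ (tperm (first_index i) i))) tpermR.
  by rewrite -val_eqE.
by case: ifP => _; rewrite mulrC.
Qed.

Lemma card_others i : #|predC1 i|%:R = c.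
Proof. by rewrite cardC1 card_ord -subn1 natrB// (leq_trans _ q3). Qed.

Lemma sum_phi_at (f : R -> R) i s :
  \sum_k f (phi_at i s 0 k) = f ((1 + c * s) / q%:R) + c * f ((1 - s) / q%:R).
Proof.
rewrite (bigD1 i)//= phi_atE eqxx; congr (_ + _).
rewrite (eq_bigr (fun=> f ((1 - s) / q%:R))) => [|k ki]; last first.
  by rewrite phi_atE (negbTE ki).
rewrite sumr_const -[_ *+ _]mulr_natl; congr (_ * _).
exact: card_others.
Qed.

Lemma phi_at_simplex i s : 0 <= s -> s < 1 -> simplex q (phi_at i s).
Proof.
move=> s0 slt1; split=> [k|].
  have ? := cs_gt0 _ c1 s s0.
  by rewrite phi_atE; case: ifP => _; rewrite divr_ge0 ?(ltW q0)//; lra.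
rewrite (sum_phi_at id)/=; field; exact: lt0r_neq0.
Qed.

Lemma macro_energy_phi_at i s :
  macro_energy (phi_at i s) = beta / (2 * q%:R) + c / q%:R * energy c beta s.
Proof.
rewrite /macro_energy sum_phi_at /site_energy /energy !invrK.
rewrite !divfK ?lt0r_neq0//.
by field; rewrite !lt0r_neq0//; have := c1; lra.
Qed.

(** The largest coordinate sits at i; all others are at most 1 / beta, where the
slope is injective, hence equal to a common value r, and s = 1 - q r. *)
Lemma maximizer_shape v : maximizers v ->
  exists i s, [/\ v = phi_at i s, 0 <= s, s < 1 & denergy c beta s = 0].
Proof.
move=> vM; have [[v0 v1] _] := vM.
have i0 : 'I_q by exact: (Ordinal (leq_trans (isT : (0 < 3)%N) q3)).
pose i := [arg max_(k > i0) v 0 k]%O.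
have imax k : v 0 k <= v 0 i.
  by rewrite /i; case: Order.TotalTheory.arg_maxP => // m _; apply.
have [k0 k0i] : exists k, k != i.
  apply/existsP; rewrite -[X in is_true X]negbK; apply/negP => /existsPn H.
  have := @cardC1 'I_q i; rewrite card_ord eq_card0 => [qE|k].
    by move: q3; case: (q) qE => [|[|]].
  by apply/negbTE; move: (H k); rewrite !inE.
have small k : k != i -> v 0 k <= beta^-1.
  by move=> ki; apply: (@maximizer_small v i) => //; rewrite eq_sym.
pose r := v 0 k0.
have rE k : k != i -> v 0 k = r.
  move=> ki; apply/eqP; rewrite eq_le !leNgt; apply/andP; split; apply/negP => lt.
    have := @site_slope_decr R q beta q0 beta0 _ _ (maximizer_gt0 v k0 vM) lt (small k ki).
    by rewrite (maximizer_slope v k k0 vM) ltxx.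
  have := @site_slope_decr R q beta q0 beta0 _ _ (maximizer_gt0 v k vM) lt (small k0 k0i).
  by rewrite (maximizer_slope v k k0 vM) ltxx.
pose s := 1 - q%:R * r.
have r0 : 0 < r by exact: maximizer_gt0.
have rs : r = (1 - s) / q%:R by rewrite /s; field; exact: lt0r_neq0.
have sum1 : v 0 i + c * r = 1.
  rewrite -[RHS]v1 (bigD1 i)//= (eq_bigr (fun=> r)); last by move=> k ki; exact: rE.
  by rewrite sumr_const -(mulr_natl r) -(card_others i).
have ps : v 0 i = (1 + c * s) / q%:R.
  have -> : v 0 i = 1 - c * r by lra.
  by rewrite /s; field; exact: lt0r_neq0.
have slt1 : s < 1 by rewrite /s ltrBlDr ltrDl mulr_gt0.
have s0 : 0 <= s.
  have := imax k0; rewrite -/r => rp.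
  have : q%:R * r <= 1 by have := c1; rewrite -sum1; nra.
  by rewrite /s; lra.
exists i, s; split=> //.
  apply/rowP => k; rewrite phi_atE; case: eqVneq => [->//|ki].
  by rewrite rE.
have := maximizer_slope v i k0 vM; rewrite -/r /site_slope ps rs.
rewrite !divfK ?lt0r_neq0// /denergy /log_ratio => H.
have -> : beta * s = beta * ((1 + c * s) / q%:R) - beta * ((1 - s) / q%:R).
  by field; exact: lt0r_neq0.
lra.
Qed.

(** The maximizers of the one-dimensional energy over [0, 1). *)
Definition peaks : set R :=
  [set s | [/\ 0 <= s, s < 1 &
    forall t, 0 <= t -> t < 1 -> energy c beta t <= energy c beta s]].

Lemma macro_energy_phi_at_le i j s t :
  (macro_energy (phi_at i s) <= macro_energy (phi_at j t)) =
  (energy c beta s <= energy c beta t).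
Proof.
by rewrite !macro_energy_phi_at lerD2l ler_pM2l// divr_gt0//; have := c1; lra.
Qed.

Lemma maximizer_peak v : maximizers v ->
  exists i s, [/\ v = phi_at i s, peaks s & denergy c beta s = 0].
Proof.
move=> vM; have [i [s [vE s0 slt1 Ds]]] := maximizer_shape v vM.
exists i, s; split=> //; split=> // t t0 t1.
rewrite -(macro_energy_phi_at_le i i) -vE; apply: vM.2; exact: phi_at_simplex.
Qed.

(** Since some maximizer on the simplex has the form [phi_at], a maximum among
these vectors is a maximum on the simplex. *)
Lemma peak_maximizer i s : peaks s -> maximizers (phi_at i s).
Proof.
move=> [s0 slt1 smax].
have [w wM] := maximizers_nonempty.
have [j [t [wE t0 t1 _]]] := maximizer_shape w wM.
split=> [|u su]; first exact: phi_at_simplex.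
apply: (le_trans (wM.2 u su)).
by rewrite wE macro_energy_phi_at_le smax.
Qed.

Lemma exists_peak : exists2 s, peaks s & denergy c beta s = 0.
Proof.
have [w /maximizer_peak[_ [s [_ sP Ds]]]] := maximizers_nonempty.
by exists s.
Qed.

End Simplex.

(** * The equilibrium macrostates *)

Section Equilibria.
Context {R : realType} (q : nat).
Hypothesis q3 : (3 <= q)%N.
Implicit Types (beta s t : R) (i j : 'I_q).

Local Notation c := (q%:R - 1 : R).

Let c1 : 1 < c. Proof. exact: c_gt1. Qed.

Lemma ord_q : 'I_q. Proof. exact: (Ordinal (leq_trans (isT : (0 < 3)%N) q3)). Qed.

Lemma phi_at0 i : phi_at q i 0 = rho q :> 'rV[R]_q.
Proof.
by apply/rowP => k; rewrite phi_atE !mxE mulr0 addr0 subr0 mul1r if_same.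
Qed.

Lemma phi_at_inj s : s != 0 -> injective (fun i => phi_at q i s).
Proof.
move=> s0 i j /rowP/(_ i); rewrite !phi_atE eqxx; case: eqVneq => [//|_] H.
have q0 : (q%:R : R) != 0 by rewrite gt_eqF//; have := c1; lra.
move: H => /(mulIf (invr_neq0 q0)) H.
have : q%:R * s = 0 by lra.
by move/eqP; rewrite mulf_eq0 (negbTE q0) (negbTE s0).
Qed.

Lemma phi_at_neq_rho i s : s != 0 -> phi_at q i s <> rho q.
Proof.
move=> s0; rewrite -(phi_at0 i) => /rowP/(_ i); rewrite !phi_atE eqxx.
have q0 : (q%:R : R) != 0 by rewrite gt_eqF//; have := c1; lra.
move=> /(mulIf (invr_neq0 q0)); rewrite mulr0 => /addrI/eqP.
by rewrite mulf_eq0 (negbTE s0) orbF gt_eqF//; have := c1; lra.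
Qed.

Lemma energy_le0 beta s : beta <= beta_c q -> 0 <= s -> s < 1 ->
  energy c beta s <= 0.
Proof.
rewrite beta_cE => bb s0 slt1.
rewrite (@energy_shift _ c c1 (transition_beta c)).
have : (transition_beta c - beta) * s ^+ 2 >= 0 by rewrite mulr_ge0 ?sqr_ge0// subr_ge0.
have [->|sn0] := eqVneq s 0; first by rewrite energy0//; lra.
have [->|sn1] := eqVneq s (transition_s c); first by rewrite energy_transition_s//; lra.
by have := energy_lt0 _ c1 s; rewrite lt_def sn0 s0 slt1 sn1 => /(_ isT isT isT); lra.
Qed.

Lemma peaks_low beta : 0 < beta -> beta < beta_c q ->
  peaks q beta = [set 0].
Proof.
move=> b0 bb; apply/seteqP; split=> [s [s0 slt1 smax]|_ ->] /=.
  apply/eqP; rewrite -[_ == _]negbK; apply/negP => sn0.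
  have sp : 0 < s by rewrite lt_def sn0.
  have := smax 0 (lexx _) ltr01; rewrite energy0// leNgt => /negP; apply.
  have := energy_le0 _ _ (lexx (beta_c q)) s0 slt1.
  rewrite (@energy_shift _ c c1 beta) => E.
  have : 0 < (beta_c q - beta) * s ^+ 2 by rewrite mulr_gt0 ?exprn_gt0// subr_gt0.
  lra.
split=> // t t0 t1; rewrite energy0//; apply: energy_le0 => //; exact: ltW.
Qed.

Lemma peaks_critical : peaks q (beta_c q : R) = [set 0; s_of q (beta_c q)].
Proof.
have [? ?] := s_midP _ c1; have i0 := inflection_gt0 _ c1.
have ? := transition_s_lt1 _ c1.
rewrite (s_of_beta_c _ q3); apply/seteqP; split=> [s [s0 slt1 smax]|s /= sE].
  have := smax 0 (lexx _) ltr01; rewrite energy0// leNgt => /negP H /=.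
  have [|sn0] := eqVneq s 0; first by left.
  have [|sn1] := eqVneq s (transition_s c); first by right.
  case: H; rewrite beta_cE; apply: energy_lt0 => //.
  by rewrite lt_def sn0.
have ss : [/\ 0 <= s, s < 1 & energy c (beta_c q) s = 0].
  case: sE => ->; first by rewrite energy0.
  by rewrite beta_cE energy_transition_s//; split=> //; lra.
case: ss => s0 slt1 sE0; split=> // t t0 t1.
by rewrite sE0; exact: energy_le0.
Qed.

(** The energy at s is at least its value at 2 s0, which is positive. *)
Lemma peak_supercritical beta s : beta_c q < beta -> peaks q beta s ->
  denergy c beta s = 0 -> s = s_of q beta.
Proof.
rewrite beta_cE => bb [s0 slt1 smax] Ds.
have [? ?] := s_midP _ c1; have i0 := inflection_gt0 _ c1.
have i1 := transition_s_lt1 _ c1.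
have Bs : 0 < energy c beta s.
  have s10 : 0 < transition_s c by lra.
  apply: lt_le_trans (smax (transition_s c) (ltW s10) i1).
  rewrite (@energy_shift _ c c1 (transition_beta c)) energy_transition_s// add0r.
  by rewrite divr_gt0// mulr_gt0 ?exprn_gt0// subr_gt0.
have sn0 : 0 < s.
  by rewrite lt_def s0 andbT; apply: contraTneq Bs => ->; rewrite energy0// ltxx.
have is_ : inflection c < s by exact: root_gt_inflection Ds Bs.
apply/esym/(s_of_eq _ q3 _ (inflection c)) => //.
rewrite (@denergy_shift _ _ (transition_beta c)) denergy_inflection// add0r mulr_gt0//.
by rewrite subr_gt0.
Qed.

Lemma equilibrium_low beta : 0 < beta -> beta < beta_c q ->
  equilibrium q beta = [set (rho q, rho q)].
Proof.
move=> b0 bb; rewrite equilibriumE//; apply/seteqP; split=> [_ [v vM <-]|_ ->].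
  have [i [s [-> sP _]]] := maximizer_peak _ _ q3 b0 v vM.
  by move: sP; rewrite peaks_low// => ->; rewrite /= phi_at0.
exists (rho q) => //; rewrite -(phi_at0 ord_q); apply: peak_maximizer => //.
by rewrite peaks_low.
Qed.

Lemma beta_c_gt0 : 0 < beta_c q :> R.
Proof. exact: le_lt_trans (beta_low_ge0 _ q3) (beta_low_lt _ q3). Qed.

Lemma equilibrium_high beta : beta_c q < beta ->
  equilibrium q beta = [set (nu beta i, nu beta i) | i in [set: 'I_q]].
Proof.
move=> bb; have b0 : 0 < beta by exact: lt_trans beta_c_gt0 bb.
rewrite equilibriumE//; apply/seteqP; split=> [_ [v vM <-]|_ [i _ <-]].
  have [i [s [-> sP Ds]]] := maximizer_peak _ _ q3 b0 v vM.
  by exists i => //; rewrite (peak_supercritical beta s).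
exists (nu beta i) => //; apply: peak_maximizer => //.
have [s sP Ds] := exists_peak _ _ q3 b0.
by rewrite -(peak_supercritical beta s).
Qed.

Lemma equilibrium_critical :
  equilibrium q (beta_c q : R) = [set (rho q, rho q)] `|`
    [set (nu (beta_c q) i, nu (beta_c q) i) | i in [set: 'I_q]].
Proof.
have b0 := beta_c_gt0.
rewrite equilibriumE//; apply/seteqP; split=> [_ [v vM <-]|_ [->|[i _ <-]]].
- have [i [s [-> sP _]]] := maximizer_peak _ _ q3 b0 v vM.
  move: sP; rewrite peaks_critical => -[->|->]; last by right; exists i.
  by left; rewrite /= phi_at0.
- exists (rho q) => //; rewrite -(phi_at0 ord_q); apply: peak_maximizer => //.
  by rewrite peaks_critical; left.
- exists (nu (beta_c q) i) => //; apply: peak_maximizer => //.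
  by rewrite peaks_critical; right.
Qed.

Lemma s_of_neq0 beta : beta_c q <= beta -> s_of q beta != 0.
Proof.
move=> bb; rewrite gt_eqF//.
apply: lt_trans (s_mid_gt0 _ q3) (s_of_gt_mid _ q3 _ _).
exact: lt_le_trans (beta_low_lt _ q3) bb.
Qed.

End Equilibria.


Theorem theorem3p5 (R : realType) (q : nat) (hq : (3 <= q)%N) :
  (* part (a) *)
  [/\ forall beta : R, 0 < beta -> exists! s : R, is_largest_root_s q beta s,
      exists a : R,
        [/\ 0 <= a, a < beta_c q,
            forall beta : R, a < beta -> 0 < s_of q beta,
            forall beta1 beta2 : R, a < beta1 -> beta1 < beta2 ->
              s_of q beta1 < s_of q beta2 &
            forall beta : R, a < beta -> derivable (s_of q) beta 1],
      s_of q (beta_c q : R) = (q%:R - 2) / (q%:R - 1) &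
      s_of q beta @[beta --> +oo] --> (1 : R)]
  /\
  (* part (b) *)
  [/\ [/\ forall beta : R, 0 < beta -> beta < beta_c q ->
            equilibrium q beta = [set (rho q, rho q)],
          forall beta : R, beta_c q < beta ->
            equilibrium q beta =
              [set (nu beta i, nu beta i) | i in [set: 'I_q]] &
          equilibrium q (beta_c q : R) =
            [set (rho q, rho q)] `|`
            [set (nu (beta_c q) i, nu (beta_c q) i) | i in [set: 'I_q]]],
      forall beta : R, beta_c q <= beta ->
        injective (fun i : 'I_q => (nu beta i, nu beta i)),
      forall i : 'I_q,
        (nu (beta_c q : R) i, nu (beta_c q : R) i) <> (rho q, rho q) &
      nu1 q (beta_c q : R) = phi q (s_of q (beta_c q : R)) /\
      phi q (s_of q (beta_c q : R)) = phi q ((q%:R - 2) / (q%:R - 1))].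
Proof.
have sE : s_of q (beta_c q : R) = (q%:R - 2) / (q%:R - 1).
  by rewrite (s_of_beta_c _ hq) /transition_s; congr (_ / _); ring.
split.
  split.
  - move=> beta _; exists (s_of q beta); split; first exact: s_ofP.
    by move=> s; apply: largest_root_uniq; exact: s_ofP.
  - exists (beta_low q); split.
    + exact: beta_low_ge0.
    + exact: beta_low_lt.
    + move=> beta ab.
      exact: lt_trans (s_mid_gt0 _ hq) (s_of_gt_mid _ hq _ ab).
    + exact: s_of_incr.
    + exact: derivable_s_of.
  - exact: sE.
  - exact: cvg_s_of.
split.
- split; [exact: equilibrium_low|exact: equilibrium_high|].
  exact: equilibrium_critical.
- move=> beta bb i j [E _]; have s0 := s_of_neq0 _ hq _ bb.
  exact: (phi_at_inj _ hq _ s0 _ _ E).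
- move=> i [E _]; have s0 := s_of_neq0 _ hq _ (lexx (beta_c q : R)).
  exact: (phi_at_neq_rho _ hq i _ s0 E).
- by split=> [//|]; rewrite sE.
Qed.
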